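(* Let $\rho \in \mathbb{R}^m$ be given by $$\rho^k = m \cdot \max_{i \in I} \Big( \max_{x_i \in X_i} H_i^k x_i - \min_{x_i \in X_i} H_i^k x_i \Big), \qquad k = 1,\dots,m,$$ and let $\bar b = b - \rho$. Assume that the programs $\overline{\mathcal{P}}_{\mathrm{LP}}$ and $\overline{\mathcal{D}}$ (the convexified program and the dual program with resource vector $\bar b$) each have a unique optimal solution, and let $\bar\lambda^\star$ be the optimal solution of $\overline{\mathcal{D}}$. Assume moreover that there exist $\zeta > 0$ and $\tilde x_i \in \mathrm{conv}(X_i)$ for all $i \in I$ such that $$\sum_{i \in I} H_i \tilde x_i \preceq \bar b - \zeta |I| \mathbf{1},$$ where $\mathbf{1} = (1,\dots,1)^\top \in \mathbb{R}^m$. Then any $x(\bar\lambda^\star) \in \mathcal{X}(\bar\lambda^\star)$ satisfies $$J_{\mathcal{P}}(x(\bar\lambda^\star)) - J^\star_{\mathcal{P}} \le \big(m + \|\rho\|_\infty/\zeta\big) \cdot \max_{i \in I} \gamma_i, \qquad \text{where } \gamma_i = \max_{x_i \in X_i} c_i^\top x_i - \min_{x_i \in X_i} c_i^\top x_i .$$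
   Context: Let $I$ be a finite index set and $m$ a positive integer with $|I| > m$. For each $i \in I$ let $r_i, z_i$ be nonnegative integers, $n_i = r_i + z_i$, $c_i \in \mathbb{R}^{n_i}$, $H_i \in \mathbb{R}^{m \times n_i}$, and let $X_i = \{x \in \mathbb{R}^{r_i} \times \mathbb{Z}^{z_i} : A_i x \preceq d_i\}$ (with $A_i \in \mathbb{R}^{m_i \times n_i}$, $d_i \in \mathbb{R}^{m_i}$) be non-empty and compact. Let $b \in \mathbb{R}^m$. Inequalities $\preceq, \succeq$ between vectors are componentwise; $H_i^k$ is the $k$-th row of $H_i$. The mixed-integer program $\mathcal{P}$ is: minimize $J_{\mathcal{P}}(x) = \sum_{i\in I} c_i^\top x_i$ subject to $\sum_{i \in I} H_i x_i \preceq b$ and $x_i \in X_i$ for all $i \in I$; it is assumed to be feasible, and $J^\star_{\mathcal{P}}$ denotes its optimal value. The program $\overline{\mathcal{P}}_{\mathrm{LP}}$ is: minimize $\sum_{i\in I} c_i^\top x_i$ subject to $\sum_{i \in I} H_i x_i \preceq \bar b$ and $x_i \in \mathrm{conv}(X_i)$ for all $i \in I$. The dual problem $\overline{\mathcal{D}}$ is: maximize over $\lambda \in \mathbb{R}^m$, $\lambda \succeq 0$, the function $-\lambda^\top \bar b + \sum_{i \in I} \min_{x_i \in X_i} (c_i^\top x_i + \lambda^\top H_i x_i)$. Let $\mathrm{vert}(X_i)$ denote the set of vertices of $\mathrm{conv}(X_i)$. For $\lambda \succeq 0$ put $\mathcal{X}_i(\lambda) = \mathrm{vert}(X_i) \cap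 \arg\min_{x_i \in X_i} (c_i^\top x_i + \lambda^\top H_i x_i)$ and $\mathcal{X}(\lambda) = \prod_{i\in I} \mathcal{X}_i(\lambda)$. *)

(* Defs.v *)
From HB Require Export structures.
From mathcomp Require Export all_boot all_order all_algebra.
From mathcomp Require Export all_classical all_reals all_analysis.
Set Implicit Arguments.
Unset Strict Implicit.
Unset Printing Implicit Defensive.
Import Order.TTheory GRing.Theory Num.Theory.
Import numFieldNormedType.Exports.

Local Open Scope classical_set_scope.
Local Open Scope ring_scope.
Local Open Scope convex_scope.

Definition vle (R : realType) (m : nat) (u v : 'cV[R]_m) : Prop :=
  forall k, u k 0 <= v k 0.

Definition dotv (R : realType) (n : nat) (u v : 'cV[R]_n) : R :=
  (u^T *m v) 0 0.

(* [sup] and [inf] are 0 on empty or unbounded sets. Below, [maxval] and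
   [minval] are only taken over non-empty compact sets, of continuous
   functions, so they are the attained maximum and minimum. *)
Definition maxval (R : realType) (T : Type) (S : set T) (f : T -> R) : R :=
  sup (f @` S).

Definition minval (R : realType) (T : Type) (S : set T) (f : T -> R) : R :=
  inf (f @` S).

Definition argmin (R : realType) (T : Type) (S : set T) (f : T -> R) : set T :=
  [set x | S x /\ forall y, S y -> f x <= f y].

Definition argmax (R : realType) (T : Type) (S : set T) (f : T -> R) : set T :=
  [set x | S x /\ forall y, S y -> f y <= f x].

Definition mixed_integer_set (R : realType) (r z p : nat)
    (A : 'M[R]_(p, r + z)) (d : 'cV[R]_p) : set 'cV[R]_(r + z) :=
  [set x | (forall j : 'I_z, dsubmx x j 0 \is a Num.int) /\ vle (A *m x) d].

Definition conv_hull (R : realType) (n : nat) (X : set 'cV[R]_n) :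
    set 'cV[R]_n :=
  smallest (@convex_set R 'cV[R]_n) X.

(* The vertices of the polytope conv(X), as its extreme points. *)
Definition vert (R : realType) (n : nat) (X : set 'cV[R]_n) : set 'cV[R]_n :=
  [set v | conv_hull X v /\
    forall (x y : convex_lmodType 'cV[R]_n) (t : {i01 R}),
      conv_hull X x -> conv_hull X y -> 0 < t%:num -> t%:num < 1 ->
      v = x <| t |> y -> x = v /\ y = v].

Definition cost (R : realType) (I : finType) (n : I -> nat)
    (c : forall i, 'cV[R]_(n i)) (x : forall i, 'cV[R]_(n i)) : R :=
  \sum_(i : I) dotv (c i) (x i).

Definition feasible (R : realType) (I : finType) (m : nat) (n : I -> nat)
    (H : forall i, 'M[R]_(m, n i)) (X : forall i, set 'cV[R]_(n i))
    (b : 'cV[R]_m) : set (forall i, 'cV[R]_(n i)) :=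
  [set x | vle (\sum_(i : I) H i *m x i) b /\ forall i, X i (x i)].

Definition lagrangian (R : realType) (m n : nat) (c : 'cV[R]_n)
    (H : 'M[R]_(m, n)) (lam : 'cV[R]_m) (x : 'cV[R]_n) : R :=
  dotv c x + dotv lam (H *m x).

Definition dual_obj (R : realType) (I : finType) (m : nat) (n : I -> nat)
    (c : forall i, 'cV[R]_(n i)) (H : forall i, 'M[R]_(m, n i))
    (X : forall i, set 'cV[R]_(n i)) (b lam : 'cV[R]_m) : R :=
  - dotv lam b + \sum_(i : I) minval (X i) (lagrangian (c i) (H i) lam).

Definition dual_opt (R : realType) (I : finType) (m : nat) (n : I -> nat)
    (c : forall i, 'cV[R]_(n i)) (H : forall i, 'M[R]_(m, n i))
    (X : forall i, set 'cV[R]_(n i)) (b : 'cV[R]_m) : set 'cV[R]_m :=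
  argmax [set lam | vle 0 lam] (dual_obj c H X b).

Definition dual_responses (R : realType) (I : finType) (m : nat) (n : I -> nat)
    (c : forall i, 'cV[R]_(n i)) (H : forall i, 'M[R]_(m, n i))
    (X : forall i, set 'cV[R]_(n i)) (lam : 'cV[R]_m) :
    set (forall i, 'cV[R]_(n i)) :=
  [set x | forall i,
     (vert (X i) `&` argmin (X i) (lagrangian (c i) (H i) lam)) (x i)].

Definition spread (R : realType) (T : Type) (S : set T) (f : T -> R) : R :=
  maxval S f - minval S f.

(* A maximum over the finite type [I]; starting the iteration at 0 is harmless
   because it is only used for non-negative families (spreads). *)
Definition max_over (R : realType) (I : finType) (g : I -> R) : R :=
  \big[Num.max/0]_(i : I) g i.

(* Main.v *)
Require Import Defs.
From mathcomp Require Import ring lra zify.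
Set Implicit Arguments.
Unset Strict Implicit.
Unset Printing Implicit Defensive.
Import Order.TTheory GRing.Theory Num.Theory.
Import numFieldNormedType.Exports.
Local Open Scope classical_set_scope.
Local Open Scope ring_scope.

(** Write [L i] for the Lagrangian of block [i] at the dual optimum [lam], and
    [dual_face i] for the face of conv(X_i) on which [L i] is minimal. The
    response [x i] lies on that face. The bound follows from three facts.

    - The response [x] agrees with the optimum [xbar] of the convexified
      program on all but at most [m] blocks ([dual_responses_agree]), so
      replacing [x] by [xbar] changes the cost by at most [m] times the largest
      cost spread.
    - Weak duality ([weak_duality]) compares [xbar], which is optimal for the
      resources [bbar = b - rho], with any point feasible for [b]: the cost of
      [xbar] is larger by at most [dotv lam rho], hence by at most |rho| times
      the sum of the multipliers.
    - Weak duality at the Slater point bounds the sum of the multipliers by the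
      largest cost spread divided by [zeta].

    The heart is the first fact, in which both uniqueness assumptions enter.
    Each [X i] has a finite subset containing a minimizer of every linear form
    ([mixed_integer_minimizers]), so the dual function is concave and piecewise
    linear. Its maximum being unique, it is sharp: the dual function strictly
    decreases to first order in every nonzero admissible direction
    ([dual_direction_eq0]). By Farkas' lemma, the supergradients at [lam]
    together with the slack directions then span every vector with nonnegative
    coefficients. Applied to the resource excess of [x], negated, this yields a
    point [xbar] of the product of the dual faces which is primal optimal and
    from which one can move, inside each face, both towards [x i] and away
    from it ([dual_face_core]); this is strict complementarity in geometric
    form. If [x i] and [xbar i] differed for more than [m] blocks, the vectors
    [H i *m (x i - xbar i)] of these blocks would be linearly dependent, and
    moving [xbar] along the dependence would produce a second primal optimum. *)

(** * Dot products *)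

Section DotProduct.
Variables (R : realType) (n : nat).
Implicit Types u v w : 'cV[R]_n.

Lemma dotvE u v : dotv u v = \sum_k u k 0 * v k 0.
Proof. by rewrite /dotv mxE; apply: eq_bigr => k _; rewrite mxE. Qed.

Lemma dotvC u v : dotv u v = dotv v u.
Proof. by rewrite !dotvE; apply: eq_bigr => k _; rewrite mulrC. Qed.

Lemma dotvDr u v w : dotv u (v + w) = dotv u v + dotv u w.
Proof. by rewrite /dotv mulmxDr mxE. Qed.

Lemma dotvZr a u v : dotv u (a *: v) = a * dotv u v.
Proof. by rewrite /dotv -scalemxAr mxE. Qed.

Lemma dotvNr u v : dotv u (- v) = - dotv u v.
Proof. by rewrite /dotv mulmxN mxE. Qed.

Lemma dotvBr u v w : dotv u (v - w) = dotv u v - dotv u w.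
Proof. by rewrite dotvDr dotvNr. Qed.

Lemma dotv0r u : dotv u 0 = 0.
Proof. by rewrite /dotv mulmx0 mxE. Qed.

Lemma dotv_sumr (J : Type) (s : seq J) (P : pred J) u (F : J -> 'cV[R]_n) :
  dotv u (\sum_(j <- s | P j) F j) = \sum_(j <- s | P j) dotv u (F j).
Proof. by rewrite /dotv mulmx_sumr summxE. Qed.

Lemma dotvDl u v w : dotv (u + v) w = dotv u w + dotv v w.
Proof. by rewrite dotvC dotvDr !(dotvC w). Qed.

Lemma dotvZl a u v : dotv (a *: u) v = a * dotv u v.
Proof. by rewrite dotvC dotvZr dotvC. Qed.

Lemma dotvNl u v : dotv (- u) v = - dotv u v.
Proof. by rewrite dotvC dotvNr dotvC. Qed.

Lemma dotvBl u v w : dotv (u - v) w = dotv u w - dotv v w.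
Proof. by rewrite dotvDl dotvNl. Qed.

Lemma dotv0l u : dotv 0 u = 0.
Proof. by rewrite dotvC dotv0r. Qed.

Lemma dotv_delta u k : dotv u (delta_mx k 0) = u k 0.
Proof.
rewrite dotvE (bigD1 k)//= big1 ?addr0 => [|j jk].
  by rewrite mxE !eqxx mulr1.
by rewrite mxE (negbTE jk) mulr0.
Qed.

Lemma dotv_self_ge0 u : 0 <= dotv u u.
Proof. by rewrite dotvE sumr_ge0// => k _; rewrite -expr2 sqr_ge0. Qed.

Lemma dotv_eq0 u : dotv u u = 0 -> u = 0.
Proof.
rewrite dotvE => /eqP; rewrite psumr_eq0 => [/allP u0|k _]; last first.
  by rewrite -expr2 sqr_ge0.
apply/colP => k; rewrite mxE; apply/eqP.
by have := u0 k (mem_index_enum _); rewrite /= mulf_eq0 orbb.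
Qed.

Lemma coord_le_norm u k : `|u k 0| <= `|u|.
Proof.
rewrite [leRHS]/Num.norm/= mx_normrE.
exact: (le_bigmax 0 (fun ij => `|u ij.1 ij.2|) (k, 0)).
Qed.

End DotProduct.

(** At fixed multipliers the Lagrangian is a single linear form, so every
    statement on linear forms applies to it. *)
Lemma lagrangianE (R : realType) m n (c : 'cV[R]_n) (H : 'M[R]_(m, n)) lam :
  lagrangian c H lam = dotv (c + H^T *m lam).
Proof.
apply/funext => x; rewrite /lagrangian dotvDl; congr (_ + _).
by rewrite /dotv trmx_mul trmxK mulmxA.
Qed.

(** * Farkas' lemma and linear dependence *)

(** Bartl's induction on the number of generators. If the generators other than
    the first already imply nonnegativity on [g], the first gets coefficient 0.
    Otherwise some [u] separates [g] from them; projecting everything along the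
    first generator onto the orthogonal of [u] reduces to one generator less,
    and the coefficient recovered for the first generator has the right sign
    thanks to the choice of [u]. *)
Lemma farkas_ord (R : realType) (m n : nat) (a : 'I_n -> 'cV[R]_m)
    (g : 'cV[R]_m) :
  (forall u, (forall j, 0 <= dotv u (a j)) -> 0 <= dotv u g) ->
  exists p : 'I_n -> R, (forall j, 0 <= p j) /\ g = \sum_j p j *: a j.
Proof.
elim: n a g => [a g ag|n IH a g ag].
  have g0 : g = 0.
    apply: dotv_eq0; apply/eqP; rewrite eq_le dotv_self_ge0 andbT -oppr_ge0.
    by rewrite -dotvNl; apply: ag => -[].
  by exists (fun=> 0); split=> //; rewrite big_ord0.
pose a' j := a (lift ord0 j).
have [|] := pselect (forall u, (forall j, 0 <= dotv u (a' j)) -> 0 <= dotv u g).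
  move=> /IH [p [p0 gE]].
  exists (fun j => if unlift ord0 j is Some k then p k else 0); split.
    by move=> j; case: unliftP.
  rewrite big_ord_recl unlift_none scale0r add0r gE.
  by apply: eq_bigr => j _; rewrite liftK.
(* [u] is nonnegative on the other generators but negative on [g], so it has
   to be negative on [a ord0]. *)
move=> /existsNP [u /not_implyP [ua' /negP]]; rewrite -ltNge => ug.
have ua0 : dotv u (a ord0) < 0.
  rewrite ltNge; apply/negP => ua0; move: ug; rewrite ltNge => /negP; apply.
  by apply: ag => j; case: (unliftP ord0 j) => [k|] ->; [exact: ua'|].
set s := dotv u (a ord0) in ua0.
pose proj y := y - (dotv u y / s) *: a ord0.
have projE v y :
    dotv v (proj y) = dotv (v - (dotv v (a ord0) / s) *: u) y.
  by rewrite /proj dotvBr dotvZr dotvBl dotvZl; ring.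
have [v a'v|p [p0 gE]] := IH (fun j => proj (a' j)) (proj g).
  rewrite projE; apply: ag => j; case: (unliftP ord0 j) => [k|] ->.
    by have := a'v k; rewrite projE.
  rewrite dotvBl dotvZl -/s divfK ?subrr//; exact: ltr0_neq0.
exists (fun j => if unlift ord0 j is Some k then p k
                 else dotv u g / s - \sum_k p k * (dotv u (a' k) / s)); split.
  move=> j; case: unliftP => // _.
  rewrite subr_ge0 (@le_trans _ _ 0)//.
    apply: sumr_le0 => k _; rewrite mulr_ge0_le0//.
    by rewrite ler_ndivrMr// mul0r.
  by rewrite ler_ndivlMr// mul0r ltW.
rewrite big_ord_recl unlift_none.
rewrite (eq_bigr (fun k => p k *: a' k)) => [|k _]; last by rewrite liftK.
have {}gE : g = \sum_k p k *: proj (a' k) + (dotv u g / s) *: a ord0.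
  by rewrite -gE /proj subrK.
rewrite [LHS]gE scalerBl addrC -addrA; congr (_ + _).
rewrite scaler_suml -sumrN -big_split/=; apply: eq_bigr => k _.
by rewrite /proj scalerBr scalerA addrC.
Qed.

Lemma farkas (R : realType) (m : nat) (J : finType) (P : pred J)
    (a : J -> 'cV[R]_m) (g : 'cV[R]_m) :
  (forall u, (forall j, P j -> 0 <= dotv u (a j)) -> 0 <= dotv u g) ->
  exists p : J -> R, (forall j, 0 <= p j) /\ g = \sum_(j | P j) p j *: a j.
Proof.
move=> ag.
have [u au|p [p0 gE]] :=
    @farkas_ord R m #|P| (fun j => a (enum_val j)) g.
  apply: ag => j Pj; have jP : j \in P by [].
  by have := au (enum_rank_in jP j); rewrite enum_rankK_in.
pose q j := \sum_(i < #|P| | enum_val i == j) p i.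
exists q; split=> [j|]; first by apply: sumr_ge0.
rewrite gE [RHS](eq_bigl (fun j => j \in P))// [RHS]big_enum_val/=.
apply: eq_bigr => i _; congr (_ *: _); rewrite /q (big_pred1 i)// => j /=.
exact/inj_eq/enum_val_inj.
Qed.

Lemma linear_dependence (R : realType) (I : finType) (m : nat) (D : {set I})
    (u : I -> 'cV[R]_m) : (m < #|D|)%N ->
  exists a : I -> R, [/\ forall i, i \notin D -> a i = 0,
    exists2 i, i \in D & a i != 0 & \sum_i a i *: u i = 0].
Proof.
move=> mD; pose A : 'M[R]_(#|D|, m) := \matrix_(j, k) u (enum_val j) k 0.
have : kermx A != 0.
  rewrite kermx_eq0 /row_free; apply: contraTneq mD => <-.
  by rewrite -leqNgt rank_leq_col.
move=> /rowV0Pn [b /sub_kermxP bA b0].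
pose a i := \sum_(j | enum_val j == i) b 0 j.
have aE j : a (enum_val j) = b 0 j.
  rewrite /a (big_pred1 j)// => k /=; exact/inj_eq/enum_val_inj.
have aN i : i \notin D -> a i = 0.
  move=> iD; rewrite /a big_pred0// => j; apply: contraNF iD => /eqP <-.
  exact: enum_valP.
exists a; split=> //.
  have [j bj] : exists j, b 0 j != 0 by apply/rV0Pn.
  by exists (enum_val j); rewrite ?aE//; exact: enum_valP.
rewrite (bigID (fun i => i \in D))/= [X in _ + X]big1 ?addr0; last first.
  by move=> i /aN ->; rewrite scale0r.
rewrite big_enum_val/=; apply/colP => k; rewrite summxE mxE.
move/rowP: bA => /(_ k); rewrite !mxE => bA; rewrite -[RHS]bA.
by apply: eq_bigr => j _; rewrite !mxE aE.
Qed.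

(** * Small steps *)

(** The step lengths for which a quantity that is positive at the start stays
    nonnegative contain an interval at 0; finitely many such intervals have a
    common point. A quantity that vanishes at the start must not decrease. *)
Lemma small_step (R : realType) (J : finType) (a b : J -> R) :
  (forall j, 0 <= a j) -> (forall j, a j = 0 -> 0 <= b j) ->
  exists2 t, 0 < t & forall j, 0 <= a j + t * b j.
Proof.
(* A term with [a j = 0] is 0, because division by 0 is. *)
move=> a0 b0; pose t := (1 + \sum_j `|b j| / a j)^-1.
have s0 : 0 <= \sum_j `|b j| / a j.
  by apply: sumr_ge0 => j _; rewrite divr_ge0.
have t0 : 0 < t by rewrite invr_gt0 ltr_wpDr.
exists t => // j; have [aj0|aj0] := eqVneq (a j) 0.
  by rewrite addr_ge0// mulr_ge0 ?b0// ltW.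
have ajgt0 : 0 < a j by rewrite lt_neqAle eq_sym aj0 a0.
have : t * `|b j| <= a j.
  rewrite /t mulrC ler_pdivrMr ?ltr_wpDr// mulrC -ler_pdivrMr//.
  rewrite (bigD1 j)//= addrCA lerDl addr_ge0// sumr_ge0// => k _.
  by rewrite divr_ge0.
have := ler_norm (- (t * b j)); rewrite normrN normrM (gtr0_norm t0); lra.
Qed.

(** * Convex sets and convex hulls *)

Section ConvexHull.
Variables (R : realType) (n : nat).
Implicit Types (C X : set 'cV[R]_n) (x y w : 'cV[R]_n).

Lemma convex_set_comb C x y (a b : R) :
  convex_set C -> C x -> C y -> 0 <= a -> 0 <= b -> a + b = 1 ->
  C (a *: x + b *: y).
Proof.
move=> cC Cx Cy a0 b0 ab1.
have a1 : a <= 1 by rewrite -ab1 lerDl.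
have := cC x y (Itv01 a0 a1) (mem_set Cx) (mem_set Cy).
by rewrite inE (_ : b = 1 - a)// -ab1 addrC addKr.
Qed.

Lemma convex_setP C :
  (forall x y (a b : R), C x -> C y -> 0 <= a -> 0 <= b -> a + b = 1 ->
     C (a *: x + b *: y)) -> convex_set C.
Proof.
move=> cC x y t /set_mem Cx /set_mem Cy; apply/mem_set.
by apply: cC => //; rewrite ?subr_ge0// addrC subrK.
Qed.

(** The base point [x], of weight [a], is the accumulator of the induction: it
    absorbs the points one by one. *)
Lemma convex_set_sum C x (J : Type) (s : seq J) (P : pred J) (p : J -> R)
    (v : J -> 'cV[R]_n) (a : R) :
  convex_set C -> C x -> (forall j, P j -> C (v j)) -> (forall j, 0 <= p j) ->
  0 <= a -> a + \sum_(j <- s | P j) p j = 1 ->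
  C (a *: x + \sum_(j <- s | P j) p j *: v j).
Proof.
move=> cC Cx Cv p0; elim: s x a Cx => [|j s IH] x a Cx a0.
  by rewrite !big_nil !addr0 => ->; rewrite scale1r.
rewrite !big_cons; case: ifP => [Pj|_]; last exact: IH.
rewrite !addrA => sum1; have [apj0|apj0] := eqVneq (a + p j) 0.
  have [-> pj0] : a = 0 /\ p j = 0.
    by have := p0 j; move: a0 apj0; split; lra.
  have := IH x 0 Cx (lexx 0); rewrite pj0 !scale0r !add0r; apply.
  by rewrite -[RHS]sum1 apj0 add0r.
have apj : 0 < a + p j by rewrite lt_neqAle eq_sym apj0 addr_ge0.
rewrite (_ : a *: x + p j *: v j =
  (a + p j) *: ((a / (a + p j)) *: x + (p j / (a + p j)) *: v j)).
  apply: IH => //; last by rewrite addr_ge0.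
  apply: convex_set_comb => //; rewrite ?divr_ge0//; try exact: ltW.
  - exact: Cv.
  - by rewrite -mulrDl divff.
by rewrite scalerDr !scalerA !(mulrC (a + p j)) !divfK.
Qed.

Lemma convex_conv_hull X : convex_set (conv_hull X).
Proof.
move=> x y t /set_mem hx /set_mem hy; apply/mem_set => D [cD XD].
by apply/set_mem/cD; apply/mem_set; [apply: hx|apply: hy].
Qed.

Lemma sub_conv_hull X : X `<=` conv_hull X.
Proof. exact: sub_gen_smallest. Qed.

Lemma conv_hull_ge X w (M : R) :
  (forall x, X x -> M <= dotv w x) -> forall y, conv_hull X y -> M <= dotv w y.
Proof.
move=> XM y; apply: (@smallest_sub _ _ _ [set y | M <= dotv w y]) => //.
apply: convex_setP => {}y z a b /= My Mz a0 b0 ab1.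
rewrite dotvDr !dotvZr -[M]mul1r -ab1 mulrDl.
by rewrite lerD// ler_wpM2l.
Qed.

Lemma convex_face X w (M : R) :
  convex_set [set y | conv_hull X y /\ dotv w y = M].
Proof.
apply: convex_setP => x y a b [hx xM] [hy yM] a0 b0 ab1; split.
  by apply: convex_set_comb => //; exact: convex_conv_hull.
by rewrite dotvDr !dotvZr xM yM -mulrDl ab1 mul1r.
Qed.

End ConvexHull.

(** * Finitely many minimizers on a mixed-integer set *)

Section RigidPoints.
Variables (R : realType) (r z p : nat) (A : 'M[R]_(p, r + z)) (d : 'cV[R]_p).
Implicit Types x y u f : 'cV[R]_(r + z).

Definition tight_rows x : {set 'I_p} := [set k | (A *m x) k 0 == d k 0].

(** A rigid point cannot move along a line while keeping its integer
    coordinates and its tight rows: it is a vertex of the slice of the set with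
    the same integer part. *)
Definition rigid x : Prop :=
  mixed_integer_set A d x /\
  forall u, dsubmx u = 0 ->
    (forall k, k \in tight_rows x -> (A *m u) k 0 = 0) -> u = 0.

Lemma rigid_inj x y : rigid x -> tight_rows x = tight_rows y ->
  dsubmx x = dsubmx y -> x = y.
Proof.
move=> [_ rx] xy dxy; apply/subr0_eq/rx; first by rewrite raddfB/= dxy subrr.
move=> k kx; have := kx; rewrite xy inE => /eqP ky.
move: kx; rewrite inE => /eqP kx.
by rewrite mulmxBr mxE [X in _ + X]mxE kx ky subrr.
Qed.

(** Starting at a point that is not rigid, move along a direction that keeps
    the tight rows and does not increase the form, until a new row becomes
    tight. The number of tight rows grows, so this ends at a rigid point. *)
Lemma rigid_below (M : R) f x :
  (forall y, mixed_integer_set A d y -> forall k, `|y k 0| <= M) ->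
  mixed_integer_set A d x -> exists2 v, rigid v & dotv f v <= dotv f x.
Proof.
move=> XM; have [N] := ubnP (p - #|tight_rows x|).
elim: N x => // N IH x xN Xx.
have [|nrx] := pselect (rigid x); first by exists x.
have [u [du Tu u0 fu]] : exists u, [/\ dsubmx u = 0,
    forall k, k \in tight_rows x -> (A *m u) k 0 = 0, u != 0 & dotv f u <= 0].
  have /existsNP[u /not_implyP[du /not_implyP[Tu /eqP u0]]] :
      ~ forall u, dsubmx u = 0 ->
        (forall k, k \in tight_rows x -> (A *m u) k 0 = 0) -> u = 0.
    by move=> rx; apply: nrx.
  have [fu|fu] := leP (dotv f u) 0; first by exists u.
  exists (- u); split; rewrite ?oppr_eq0//.
  - by rewrite raddfN/= du oppr0.
  - by move=> k /Tu Auk; rewrite mulmxN mxE Auk oppr0.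
  - by rewrite dotvNr oppr_le0 ltW.
have stay t : (forall k, (A *m x) k 0 + t * (A *m u) k 0 <= d k 0) ->
    mixed_integer_set A d (x + t *: u).
  move=> At; split=> [j|k]; last first.
    by rewrite mulmxDr -scalemxAr mxE [X in _ + X]mxE.
  by rewrite raddfD/= linearZ/= du scaler0 addr0; apply: (proj1 Xx).
have Axd k : (A *m x) k 0 <= d k 0 by apply: (proj2 Xx).
(* A bounded set contains no ray, so moving along [u] tightens a row. *)
have [k0 k0P] : exists k, 0 < (A *m u) k 0.
  apply/not_existsP => Au; move/eqP: u0; apply; apply/colP => j; rewrite mxE.
  apply/eqP/negP => uj.
  have uj0 : 0 < `|u j 0| by rewrite normr_gt0; exact/negP.
  (* Large enough for the coordinate [j] to exceed [M] at [x + t *: u]. *)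
  pose t := (M + `|x j 0| + 1) / `|u j 0|.
  have M0 : 0 <= M by apply: le_trans (XM _ Xx j).
  have t0 : 0 <= t by rewrite divr_ge0// !addr_ge0.
  have /XM/(_ j) : mixed_integer_set A d (x + t *: u).
    apply: stay => k; apply: le_trans (Axd k); rewrite gerDl.
    rewrite mulr_ge0_le0// leNgt; exact/negP.
  rewrite mxE [X in _ + X]mxE.
  have := lerB_normD (t * u j 0) (x j 0).
  by rewrite normrM (ger0_norm t0) /t divfK ?gt_eqF// [t * _ + _]addrC; lra.
(* [F k] is the step length at which row [k] becomes tight. *)
pose F k := (d k 0 - (A *m x) k 0) / (A *m u) k 0.
have : exists2 k, 0 < (A *m u) k 0 &
    forall i, 0 < (A *m u) i 0 -> F k <= F i.
  have [k kP kmin] := @arg_minP _ R _ k0 (fun k => 0 < (A *m u) k 0) F k0P.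
  by exists k.
move=> [k1 k1P k1min]; set t := F k1 in k1min.
have t0 : 0 <= t by rewrite divr_ge0 ?subr_ge0// ltW.
have Xt : mixed_integer_set A d (x + t *: u).
  apply: stay => k; have [Auk|Auk] := leP ((A *m u) k 0) 0.
    by apply: le_trans (Axd k); rewrite gerDl mulr_ge0_le0.
  by have := k1min k Auk; rewrite /F ler_pdivlMr//; lra.
have Axt k : (A *m (x + t *: u)) k 0 = (A *m x) k 0 + t * (A *m u) k 0.
  by rewrite mulmxDr -scalemxAr mxE [X in _ + X]mxE.
have lt_tight : (#|tight_rows x| < #|tight_rows (x + t *: u)|)%N.
  apply: proper_card; apply/properP; split.
    apply/fintype.subsetP => k kx; have := kx; rewrite !inE Axt => /eqP ->.
    by rewrite Tu// mulr0 addr0.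
  exists k1; first by rewrite inE Axt /t /F divfK ?(gt_eqF k1P)// addrC subrK.
  by apply: contraTN k1P => /Tu ->; rewrite ltxx.
have [|v rv fv] := IH _ _ Xt.
  have := max_card (tight_rows (x + t *: u)); rewrite card_ord; lia.
exists v => //; apply: le_trans fv _.
by rewrite dotvDr dotvZr gerDl mulr_ge0_le0.
Qed.

(** A rigid point is determined by its tight rows and its integer part. On a
    bounded set that pair takes finitely many values, so there are finitely
    many rigid points; by [rigid_below] one of them minimizes any given linear
    form. *)
Lemma mixed_integer_minimizers : compact (mixed_integer_set A d) ->
  mixed_integer_set A d !=set0 ->
  exists (S : finType) (v : S -> 'cV[R]_(r + z)),
    (forall s, mixed_integer_set A d (v s)) /\
    forall f x, mixed_integer_set A d x ->
      exists s, dotv f (v s) <= dotv f x.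
Proof.
move=> /compact_bounded [M0 [_ XM0]] [x0 Xx0].
have [N XN] : exists N : nat,
    forall x, mixed_integer_set A d x -> forall k, `|x k 0| <= N%:R.
  exists (Num.bound (M0 + 1)) => x Xx k.
  apply: le_trans (ltW (archi_boundP _)); last first.
    by apply: le_trans (XM0 _ _ _ Xx); rewrite ?ltrDl.
  apply: le_trans (XM0 _ _ _ Xx); last by rewrite ltrDl.
  exact: coord_le_norm.
pose code (y : R) : 'I_(2 * N).+1 := inord (Num.trunc (y + N%:R)).
have codeK (y : R) : y \is a Num.int -> `|y| <= N%:R -> y = (code y)%:R - N%:R.
  move=> yZ; rewrite ler_norml => /andP[Ny yN].
  have yN0 : 0 <= y + N%:R by lra.
  have yNnat : y + N%:R \is a Num.nat.
    by rewrite natrEint yN0 andbT rpredD ?rpred_nat.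
  rewrite inordK ?truncnK ?addrK// ltnS -(ler_nat R) truncnK// natrM; lra.
pose S := ({set 'I_p} * {ffun 'I_z -> 'I_(2 * N).+1})%type.
pose sig x : S := (tight_rows x, [ffun j => code (dsubmx x j 0)]).
have sig_inj x y : rigid x -> rigid y -> sig x = sig y -> x = y.
  move=> rx ry [xy /ffunP cxy]; apply: rigid_inj => //; apply/colP => j.
  have coord v : rigid v -> dsubmx v j 0 = (code (dsubmx v j 0))%:R - N%:R.
    move=> [Xv _]; apply: codeK; first exact: (proj1 Xv).
    by rewrite mxE; apply: XN.
  by rewrite (coord _ rx) (coord _ ry); have := cxy j; rewrite !ffunE => ->.
pose v s := if pselect (exists x, rigid x /\ sig x = s) is left e
  then projT1 (cid e) else x0.
exists S, v; split=> [s|f x Xx].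
  by rewrite /v; case: pselect => // e; case: (cid e) => x [[]].
have [y ry fy] := rigid_below f XN Xx.
exists (sig y); rewrite /v; case: pselect => [e|]; last by case; exists y.
by case: (cid e) => w /= [rw /sig_inj ->].
Qed.

End RigidPoints.

(** * Minima, maxima and spreads of linear forms *)

Section Spread.
Variables (R : realType) (n : nat) (X : set 'cV[R]_n).
Variables (S : finType) (v : S -> 'cV[R]_n).
Hypothesis X0 : X !=set0.
Hypothesis v_min : forall w x, X x -> exists s, dotv w (v s) <= dotv w x.
Implicit Types w x y : 'cV[R]_n.

Lemma minval_ge w M : (forall s, M <= dotv w (v s)) -> M <= minval X (dotv w).
Proof.
move=> Mv; apply: lb_le_inf.
  by have [x Xx] := X0; exists (dotv w x); exists x.
by move=> _ [x Xx <-]; have [s] := v_min w Xx; apply: le_trans.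
Qed.

Lemma has_lbound_dotv w : has_lbound (dotv w @` X).
Proof.
exists (- \sum_s `|dotv w (v s)|) => _ [x Xx <-].
have [s] := v_min w Xx; apply: le_trans; rewrite lerNl.
apply: le_trans (ler_norm _) _; rewrite normrN (bigD1 s)//= lerDl.
exact: sumr_ge0.
Qed.

Lemma minval_le w x : X x -> minval X (dotv w) <= dotv w x.
Proof. by move=> Xx; apply: ge_inf; [exact: has_lbound_dotv|exists x]. Qed.

Lemma maxval_ge w x : X x -> dotv w x <= maxval X (dotv w).
Proof.
move=> Xx; apply: ub_le_sup; last by exists x.
have [M Mlb] := has_lbound_dotv (- w); exists (- M) => _ [y Xy <-].
by rewrite lerNr -dotvNl; apply: Mlb; exists y.
Qed.

Lemma spread_ge w x y : conv_hull X x -> conv_hull X y ->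
  dotv w x - dotv w y <= spread X (dotv w).
Proof.
move=> hx hy; rewrite lerB//.
  rewrite -lerN2 -dotvNl; apply: conv_hull_ge hx => z Xz.
  by rewrite dotvNl lerN2 maxval_ge.
by apply: conv_hull_ge hy => z; apply: minval_le.
Qed.

End Spread.

Lemma max_over_ge (R : realType) (I : finType) (g : I -> R) i :
  g i <= max_over g.
Proof. exact: (le_bigmax 0 g i). Qed.

(** * Dual faces and the primal optimum *)

Section DualResponses.
Variables (R : realType) (I : finType) (m : nat) (n : I -> nat).
Variables (c : forall i, 'cV[R]_(n i)) (H : forall i, 'M[R]_(m, n i)).
Variables (X : forall i, set 'cV[R]_(n i)) (S : I -> finType).
Variable v : forall i, S i -> 'cV[R]_(n i).
Arguments X : clear implicits.
Hypothesis X0 : forall i, X i !=set0.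
Hypothesis v_X : forall i (s : S i), X i (v s).
Hypothesis v_min :
  forall i w x, X i x -> exists s : S i, dotv w (v s) <= dotv w x.
Variables (bbar lam : 'cV[R]_m).
Hypothesis D_unique : exists! l : 'cV[R]_m, dual_opt c H X bbar l.
Hypothesis lam_opt : dual_opt c H X bbar lam.
Variable x : forall i, 'cV[R]_(n i).
Hypothesis x_resp :
  forall i, argmin (X i) (lagrangian (c i) (H i) lam) (x i).
Implicit Types y : forall i, 'cV[R]_(n i).

Notation L i := (lagrangian (c i) (H i) lam).
Notation M i := (lagrangian (c i) (H i) lam (x i)).
Notation usage y := (\sum_i H i *m y i).

Definition dual_face i : set 'cV[R]_(n i) :=
  [set u | conv_hull (X i) u /\ L i u = M i].

Lemma convex_dual_face i : convex_set (@dual_face i).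
Proof. by rewrite /dual_face lagrangianE; apply: convex_face. Qed.

Lemma sum_lagrangian y :
  \sum_i L i (y i) = cost c y + dotv lam (usage y).
Proof. by rewrite dotv_sumr -big_split. Qed.

Lemma lagrangian_conv_ge i u : conv_hull (X i) u -> M i <= L i u.
Proof.
rewrite lagrangianE; apply: conv_hull_ge => z Xz.
by have := (x_resp i).2 z Xz; rewrite lagrangianE.
Qed.

Lemma weak_duality y : (forall i, conv_hull (X i) (y i)) ->
  \sum_i M i <= cost c y + dotv lam (usage y).
Proof.
move=> hy; rewrite -sum_lagrangian ler_sum// => i _.
exact: lagrangian_conv_ge.
Qed.

Lemma lam_ge0 k : 0 <= lam k 0.
Proof. by have [/(_ k)] := lam_opt; rewrite mxE. Qed.

Lemma dotv_lam_le (u w : 'cV[R]_m) : vle u w -> dotv lam u <= dotv lam w.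
Proof.
by move=> uw; rewrite !dotvE ler_sum// => k _; rewrite ler_wpM2l// lam_ge0.
Qed.

(** The complementary slackness conditions at [lam] on a vector [u] of unused
    resources. *)
Definition compl_slack (u : 'cV[R]_m) : Prop :=
  forall k, 0 <= u k 0 /\ (lam k 0 != 0 -> u k 0 = 0).

Lemma compl_slack_dotv u : compl_slack u -> dotv lam u = 0.
Proof.
move=> su; rewrite dotvE big1// => k _.
by have [->|/(su k).2 ->] := eqVneq (lam k 0) 0; rewrite ?mul0r ?mulr0.
Qed.

(** On the dual faces weak duality is an equality, and complementary slackness
    replaces the resource usage by [bbar]. *)
Lemma cost_dual_face y : (forall i, dual_face (y i)) ->
  compl_slack (bbar - usage y) -> cost c y = \sum_i M i - dotv lam bbar.
Proof.
move=> Fy /compl_slack_dotv/eqP; rewrite dotvBr subr_eq0 => /eqP ->.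
rewrite -(eq_bigr _ (fun i _ => (Fy i).2)) sum_lagrangian; lra.
Qed.

Lemma dual_face_optimal y : (forall i, dual_face (y i)) ->
  compl_slack (bbar - usage y) ->
  argmin (feasible H (fun i => conv_hull (X i)) bbar) (cost c) y.
Proof.
move=> Fy sy; split.
  split=> [k|i]; last by have [] := Fy i.
  by have [] := sy k; rewrite !mxE subr_ge0.
move=> y' [by' hy']; rewrite (cost_dual_face Fy sy).
have := weak_duality hy'; have := dotv_lam_le by'; lra.
Qed.

(** If no selection of minimizers on the dual faces has a negative slope along
    [u], then for small positive [t] the minimum of each block at
    [lam + t *: u] is still attained by minimizers at [lam], since the other
    finitely many candidates have a positive gap. The dual function is then not
    smaller at [lam + t *: u], which by uniqueness is [lam]. *)
Lemma dual_direction_eq0 (u : 'cV[R]_m) :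
  (forall k, lam k 0 = 0 -> 0 <= u k 0) ->
  (forall s : (forall i, S i), (forall i, L i (v (s i)) = M i) ->
     0 <= dotv u (\sum_i H i *m v (s i) - bbar)) ->
  u = 0.
Proof.
move=> lam0 su.
have vM i (s : S i) : M i <= L i (v s) by apply: (x_resp i).2.
(* Among the minimizers at [lam], pick those of smallest slope along [u]. *)
have exs i : exists s : S i, L i (v s) = M i /\ forall s' : S i,
    L i (v s') = M i -> dotv u (H i *m v s) <= dotv u (H i *m v s').
  have [s0 Ls0] : exists s : S i, L i (v s) == M i.
    have [s sx] := v_min (c i + (H i)^T *m lam) (x_resp i).1.
    by exists s; rewrite eq_le vM andbT lagrangianE.
  have [s /eqP Ls smin] := @arg_minP _ R _ s0 (fun s => L i (v s) == M i)
    (fun s => dotv u (H i *m v s)) Ls0.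
  by exists s; split=> // s' /eqP; apply: smin.
pose s i := projT1 (cid (exs i)).
have sM i : L i (v (s i)) = M i by have [] := projT2 (cid (exs i)).
have smin i (s' : S i) : L i (v s') = M i ->
    dotv u (H i *m v (s i)) <= dotv u (H i *m v s').
  by have [_] := projT2 (cid (exs i)); apply.
(* [a + t * b] collects what has to stay nonnegative at [lam + t *: u]: the
   multipliers, and the gap of every candidate to the selected one. *)
pose a (j : 'I_m + {i : I & S i}) : R := match j with
  | inl k => lam k 0 | inr e => L (tag e) (v (tagged e)) - M (tag e) end.
pose b (j : 'I_m + {i : I & S i}) : R := match j with
  | inl k => u k 0
  | inr e => dotv u (H (tag e) *m v (tagged e)) -
             dotv u (H (tag e) *m v (s (tag e))) end.
have [||t t0 tab] := @small_step _ _ a b.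
- by move=> [k|[i s']] /=; rewrite ?lam_ge0// subr_ge0.
- move=> [k|[i s']] /=; first exact: lam0.
  by move=> /eqP; rewrite !subr_eq0 subr_ge0 => /eqP; apply: smin.
have lamtu i (w : 'cV[R]_(n i)) :
    lagrangian (c i) (H i) (lam + t *: u) w = L i w + t * dotv u (H i *m w).
  by rewrite /lagrangian dotvDl dotvZl addrA.
have obj_le : dual_obj c H X bbar lam <= dual_obj c H X bbar (lam + t *: u).
  apply: (@le_trans _ _ (- dotv lam bbar + \sum_i M i +
      t * dotv u (\sum_i H i *m v (s i) - bbar))).
    apply: ler_wpDr; first by rewrite mulr_ge0 ?su// ltW.
    rewrite lerD2l ler_sum// => i _; rewrite [in leLHS]lagrangianE.
    by have := minval_le (@v_min i) (c i + (H i)^T *m lam) (x_resp i).1;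
      rewrite lagrangianE.
  rewrite /dual_obj dotvDl dotvZl dotvBr dotv_sumr.
  have : \sum_i M i + t * \sum_i dotv u (H i *m v (s i)) <=
      \sum_i minval (X i) (lagrangian (c i) (H i) (lam + t *: u)).
    rewrite mulr_sumr -big_split ler_sum// => i _.
    rewrite [in leRHS]lagrangianE.
    apply: (minval_ge (X0 i) (@v_min i)) => s'; rewrite -lagrangianE lamtu.
    by have := tab (inr (Tagged S s')); rewrite /= mulrBr; lra.
  lra.
have opt' : dual_opt c H X bbar (lam + t *: u).
  split=> [k|mu mu0]; last exact: le_trans (lam_opt.2 _ mu0) obj_le.
  by rewrite !mxE; apply: (tab (inl k)).
have [l [_ lU]] := D_unique.
have := lU _ opt'; rewrite -(lU _ lam_opt) => /eqP.
rewrite addrC -subr_eq subrr eq_sym scaler_eq0 gt_eqF//= => /eqP //.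
Qed.

(** By [dual_direction_eq0] no nonzero vector is nonnegative on all the
    generators below, so Farkas' lemma writes [bbar - usage x] as a nonnegative
    combination of them. Averaging [x] with the selections that occur, with
    these weights, gives [xbar]; the slack generators become its unused
    resources. Since [x i] itself has a positive weight in [xbar i], the segment
    from [x i] to [xbar i] can be prolonged inside the face. *)
Lemma dual_face_core : exists xbar, exists2 eta : R, 0 < eta &
  compl_slack (bbar - usage xbar) /\
  forall i t, `|t| <= eta -> dual_face (xbar i + t *: (x i - xbar i)).
Proof.
pose P (j : {dffun forall i, S i} + 'I_m) := match j with
  | inl s => [forall i, L i (v (s i)) == M i] | inr k => lam k 0 == 0 end.
pose a (j : {dffun forall i, S i} + 'I_m) : 'cV[R]_m := match j with
  | inl s => \sum_i H i *m v (s i) - bbar | inr k => delta_mx k 0 end.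
have [u ua|p [p0]] := @farkas _ _ _ P a (bbar - usage x).
  rewrite (@dual_direction_eq0 u) ?dotv0l// => [k k0|s sM].
    by have := ua (inr k); rewrite /= dotv_delta; apply; apply/eqP.
  have := ua (inl (finfun s)); rewrite /= (eq_bigr (fun i => H i *m v (s i))).
    by apply; apply/forallP => i; rewrite ffunE sM.
  by move=> i _; rewrite ffunE.
rewrite big_sumType /a/=; set sl := (X in _ = _ + X).
pose Ps (s : {dffun forall i, S i}) := [forall i, L i (v (s i)) == M i].
pose q := \sum_(s | Ps s) p (inl s).
rewrite -/Ps => xE.
have q0 : 0 <= q by apply: sumr_ge0.
have q1 : 0 < 1 + q by rewrite ltr_wpDr.
have slE k : sl k 0 = if lam k 0 == 0 then p (inr k) else 0.
  rewrite /sl summxE big_mkcond (bigD1 k)//= big1 ?addr0 => [|j jk].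
    by rewrite !mxE !eqxx mulr1.
  by rewrite !mxE [k == j]eq_sym (negbTE jk) mulr0 if_same.
pose w i := \sum_(s | Ps s) p (inl s) *: v (s i).
pose xb i := (1 + q)^-1 *: (x i + w i).
(* [(1 + q)^-1] is the weight of [x i] in [xb i]. *)
exists xb, (1 + q)^-1; first by rewrite invr_gt0.
split.
  have -> : bbar - usage xb = (1 + q)^-1 *: sl.
    have usage_w : usage w =
        \sum_(s | Ps s) p (inl s) *: \sum_i H i *m v (s i).
      rewrite /w; under eq_bigr do rewrite mulmx_sumr.
      rewrite exchange_big; apply: eq_bigr => s _ /=.
      by rewrite scaler_sumr; apply: eq_bigr => i _; rewrite scalemxAr.
    have -> : usage xb = (1 + q)^-1 *: (usage x + usage w).
      rewrite -big_split scaler_sumr; apply: eq_bigr => i _ /=.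
      by rewrite -scalemxAr mulmxDr.
    have -> : sl = (1 + q) *: bbar - (usage x + usage w).
      have {xE} : bbar - usage x = usage w - q *: bbar + sl.
        rewrite xE usage_w; congr (_ + _).
        under eq_bigr do rewrite scalerBr.
        by rewrite sumrB -scaler_suml.
      move: (usage x) (usage w) (sl) => ux uw sl' /colP xE.
      by apply/colP => k; have := xE k; rewrite !mxE; lra.
    by rewrite scalerBr scalerK ?gt_eqF.
  move=> k; rewrite mxE slE; split.
    by case: ifP => _; rewrite mulr_ge0// invr_ge0 ltW.
  by move=> /negbTE ->; rewrite mulr0.
move=> i t tq.
have -> : xb i + t *: (x i - xb i) =
    ((1 + t * q) / (1 + q)) *: x i +
    \sum_(s | Ps s) ((1 - t) / (1 + q) * p (inl s)) *: v (s i).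
  under eq_bigr do rewrite -scalerA.
  rewrite -scaler_sumr -/(w i) /xb; move: (w i) => wi.
  by apply/colP => k; rewrite !mxE; field; rewrite gt_eqF.
have [tq1 tq2] : - (1 + q)^-1 <= t /\ t <= (1 + q)^-1.
  by apply/andP; rewrite -ler_norml.
have q11 : (1 + q)^-1 <= 1 by rewrite invf_le1// lerDl.
apply: convex_set_sum.
- exact: convex_dual_face.
- by split=> //; apply: sub_conv_hull; apply: (x_resp i).1.
- move=> s /forallP/(_ i)/eqP sM; split=> //.
  by apply: sub_conv_hull; apply: v_X.
- move=> s; rewrite mulr_ge0// divr_ge0 ?(ltW q1)// subr_ge0.
  exact: le_trans tq2 q11.
- rewrite divr_ge0 ?(ltW q1)//.
  have : - 1 <= - (1 + q)^-1 * q.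
    rewrite mulNr lerN2 mulrC ler_pdivrMr//; lra.
  have : - (1 + q)^-1 * q <= t * q by rewrite ler_wpM2r.
  lra.
- rewrite -mulr_sumr -/q; by field; rewrite gt_eqF.
Qed.

(** A linear dependence between more than [m] resource displacements moves the
    point of [dual_face_core] without changing its resource usage, inside the
    dual faces, hence to another primal optimum. *)
Lemma dual_responses_agree :
  (exists! y, argmin (feasible H (fun i => conv_hull (X i)) bbar) (cost c) y) ->
  exists xbar, [/\ forall i, dual_face (xbar i),
    compl_slack (bbar - usage xbar) & (#|[set i | x i != xbar i]%SET| <= m)%N].
Proof.
move=> [y0 [_ y0U]]; have [xb [eta eta0 [sxb mv]]] := dual_face_core.
have Fxb i : dual_face (xb i).
  by have := mv i 0; rewrite scale0r addr0 normr0; apply; exact: ltW.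
exists xb; split=> //; rewrite leqNgt; apply/negP => mD.
have [a [aN [i0 i0D ai0] au0]] :=
  linear_dependence (fun i => H i *m (x i - xb i)) mD.
pose N := 1 + \sum_i `|a i|.
have N0 : 0 < N by rewrite ltr_wpDr// sumr_ge0.
have aN1 i : `|a i| <= N.
  by rewrite /N (bigD1 i)//= addrCA lerDl addr_ge0// sumr_ge0.
(* Scaled so that every block moves by at most [eta]. *)
pose t i := eta / N * a i.
pose y i := xb i + t i *: (x i - xb i).
have usage_y : usage y = usage xb.
  rewrite /y; under eq_bigr do rewrite mulmxDr -scalemxAr -scalerA.
  by rewrite big_split/= -scaler_sumr au0 scaler0 addr0.
have Fy i : dual_face (y i).
  apply: mv; rewrite normrM gtr0_norm ?divr_gt0// mulrAC.
  by rewrite ler_pdivrMr// ler_pM2l.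
have sy : compl_slack (bbar - usage y) by rewrite usage_y.
have yxb : y = xb.
  rewrite -(y0U _ (dual_face_optimal Fy sy)).
  exact: y0U (dual_face_optimal Fxb sxb).
have /eqP : y i0 - xb i0 = 0 by rewrite yxb subrr.
rewrite /y addrAC subrr add0r scaler_eq0 /t !mulf_eq0 invr_eq0.
rewrite (gt_eqF eta0) (gt_eqF N0) (negbTE ai0) subr_eq0/=.
by move: i0D; rewrite inE => /negbTE ->.
Qed.

End DualResponses.

(** * The performance bound *)

Theorem theorem3p3 (R : realType) (I : finType) (m : nat)
    (m_gt0 : (0 < m)%N) (m_lt_I : (m < #|I|)%N)
    (r z p : I -> nat)
    (c : forall i, 'cV[R]_(r i + z i))
    (H : forall i, 'M[R]_(m, r i + z i))
    (A : forall i, 'M[R]_(p i, r i + z i))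
    (d : forall i, 'cV[R]_(p i))
    (b : 'cV[R]_m)
    (X : forall i, set 'cV[R]_(r i + z i))
    (X_def : forall i, X i = mixed_integer_set (A i) (d i))
    (X_neq0 : forall i, X i !=set0)
    (X_compact : forall i, compact (X i))
    (P_feasible : feasible H X b !=set0)
    (rho bbar lam : 'cV[R]_m)
    (rho_def : forall k : 'I_m,
      rho k 0 = m%:R *
        max_over (fun i => spread (X i) (fun x => (row k (H i) *m x) 0 0)))
    (bbar_def : bbar = b - rho)
    (PLP_unique : exists! x : forall i, 'cV[R]_(r i + z i),
      argmin (feasible H (fun i => conv_hull (X i)) bbar) (cost c) x)
    (D_unique : exists! l : 'cV[R]_m, dual_opt c H X bbar l)
    (lam_opt : dual_opt c H X bbar lam)
    (zeta : R) (zeta_gt0 : 0 < zeta)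
    (slater : exists xt : forall i, 'cV[R]_(r i + z i),
      feasible H (fun i => conv_hull (X i))
        (bbar - const_mx (zeta * #|I|%:R)) xt)
    (x : forall i, 'cV[R]_(r i + z i))
    (x_resp : dual_responses c H X lam x) :
  cost c x - minval (feasible H X b) (cost c)
    <= (m%:R + `|rho| / zeta) * max_over (fun i => spread (X i) (dotv (c i))).
Proof.
have fin i : exists (S : finType) (v : S -> 'cV[R]_(r i + z i)),
    (forall s, X i (v s)) /\
    forall w y, X i y -> exists s, dotv w (v s) <= dotv w y.
  by rewrite X_def; apply: mixed_integer_minimizers; rewrite -X_def.
pose S i := projT1 (cid (fin i)).
pose v i : S i -> 'cV[R]_(r i + z i) := projT1 (cid (projT2 (cid (fin i)))).
have v_X i (s : S i) : X i (v i s).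
  by have [vX _] := projT2 (cid (projT2 (cid (fin i)))); apply: vX.
have v_min i (w y : 'cV[R]_(r i + z i)) : X i y ->
    exists s : S i, dotv w (v i s) <= dotv w y.
  by have [_ vm] := projT2 (cid (projT2 (cid (fin i)))); apply: vm.
have x_min i : argmin (X i) (lagrangian (c i) (H i) lam) (x i).
  by have [] := x_resp i.
have [xb [Fxb sxb Dm]] := dual_responses_agree X_neq0 v_X v_min D_unique
  lam_opt x_min PLP_unique.
set gamma := max_over _.
have gammaP i (y y' : 'cV[R]_(r i + z i)) :
    conv_hull (X i) y -> conv_hull (X i) y' ->
    dotv (c i) y - dotv (c i) y' <= gamma.
  move=> hy hy'; apply: le_trans (max_over_ge _ i).
  exact: (spread_ge (v_min i)).
have gamma0 : 0 <= gamma by apply: bigmax_ge_id.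
have hxb i : conv_hull (X i) (xb i) by have [] := Fxb i.
have hx i : conv_hull (X i) (x i) by apply: sub_conv_hull; case: (x_min i).
have cost_xb := cost_dual_face Fxb sxb.
(* [x] and [xb] differ on at most [m] blocks. *)
have gap_x : cost c x - cost c xb <= m%:R * gamma.
  rewrite /cost -sumrB (bigID (fun i => x i != xb i))/=.
  rewrite [X in _ + X]big1 ?addr0 => [|i /negbNE/eqP ->]; last by rewrite subrr.
  apply: (@le_trans _ _ (\sum_(i | x i != xb i) gamma)).
    by apply: ler_sum => i _; apply: gammaP.
  rewrite (eq_bigl (fun i => i \in [set i | x i != xb i]%SET)); last first.
    by move=> i; rewrite inE.
  by rewrite sumr_const -[leLHS]mulr_natl ler_wpM2r// ler_nat.
(* Weak duality at the Slater point, whose margin is [zeta * #|I|] in every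
   resource, while its cost exceeds that of [xb] by at most [#|I| * gamma]. *)
have lam_sum : zeta * \sum_k lam k 0 <= gamma.
  have [xt [use_xt hxt]] := slater.
  have cardI : 0 < #|I|%:R :> R by rewrite ltr0n (leq_trans _ m_lt_I).
  have := weak_duality x_min hxt; have := dotv_lam_le lam_opt use_xt.
  have : cost c xt - cost c xb <= #|I|%:R * gamma.
    rewrite /cost -sumrB mulr_natl -sumr_const ler_sum// => i _.
    exact: gammaP.
  have -> : dotv lam (bbar - const_mx (zeta * #|I|%:R)) =
      dotv lam bbar - #|I|%:R * (zeta * \sum_k lam k 0).
    rewrite dotvBr; congr (_ - _); rewrite dotvE.
    under eq_bigr do rewrite mxE mulrC.
    by rewrite -mulr_sumr mulrA [#|I|%:R * _]mulrC.
  move=> h1 h2 h3; rewrite -(ler_pM2l cardI); lra.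
have lam_rho : dotv lam rho <= `|rho| / zeta * gamma.
  apply: (@le_trans _ _ (`|rho| * \sum_k lam k 0)).
    rewrite dotvE mulr_sumr ler_sum// => k _; rewrite mulrC.
    rewrite ler_wpM2r ?(lam_ge0 lam_opt)//.
    exact: le_trans (ler_norm _) (coord_le_norm _ _).
  by rewrite -mulrA ler_wpM2l// mulrC ler_pdivlMr// mulrC.
suff : cost c x - (m%:R + `|rho| / zeta) * gamma
    <= minval (feasible H X b) (cost c) by lra.
apply: lb_le_inf.
  by have [y Py] := P_feasible; exists (cost c y); exists y.
move=> _ [y [use_y Xy] <-].
have := weak_duality x_min (fun i => sub_conv_hull (Xy i)).
have := dotv_lam_le lam_opt use_y.
by move: cost_xb; rewrite bbar_def dotvBr; lra.
Qed.
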